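(* There is a polynomial-time algorithm that, given an instance $I$ of SMC, either outputs a feasible matching for $I$ with at most $(\Delta_{\mathcal W}-1)|\mathcal M^\star|+(\Delta_{\mathcal M}-1)|\mathcal W^\star|$ blocking pairs, or correctly concludes that no feasible matching exists for $I$.
   Context: An instance of Stable Marriage with Covering Constraints (SMC) consists of a finite set $\mathcal M$ of men, a finite set $\mathcal W$ of women, for each person $x$ a preference list $L(x)$ strictly ordering a subset of the opposite sex (the persons acceptable to $x$), and subsets $\mathcal W^\star\subseteq\mathcal W$, $\mathcal M^\star\subseteq\mathcal M$ of distinguished persons. A matching is a set of disjoint man–woman pairs $\{m,w\}$ with $m$ and $w$ in each other's lists; $M(x)$ denotes the partner of $x$. A pair $\{m,w\}$ of mutually acceptable persons is blocking for $M$ if $m$ is unmatched or prefers $w$ to $M(m)$, and $w$ is unmatched or prefers $m$ to $M(w)$. A matching is feasible if it matches every person in $\mathcal W^\star\cup\mathcal M^\star$. $\Delta_{\mathcal M}$ and $\Delta_{\mathcal W}$ denote the maximum length of the preference list of a man and of a woman, respectively. *)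

(* Defs.v *)
From mathcomp Require Import all_boot all_order all_algebra.

Set Implicit Arguments.
Unset Strict Implicit.
Unset Printing Implicit Defensive.

(* Acceptability is not required to be mutual: w may be in the list of m      *)
(* without m being in the list of w. A preference list is in decreasing order *)
(* of preference.                                                             *)
Record smc := SMC {
  men : finType;
  women : finType;
  mlist : men -> seq women;
  wlist : women -> seq men;
  mlist_uniq : forall m, uniq (mlist m);
  wlist_uniq : forall w, uniq (wlist w);
  mstar : {set men};
  wstar : {set women}
}.

Definition prefers (T : eqType) (L : seq T) (a b : T) : bool :=
  index a L < index b L.

Section Matchings.
Variable I : smc.
Implicit Types (M : {set men I * women I}) (m : men I) (w : women I).

Definition acceptable m w : bool := (w \in mlist m) && (m \in wlist w).

Definition is_matching M : Prop :=
  (forall m w, (m, w) \in M -> acceptable m w) /\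
  (forall e f, e \in M -> f \in M -> e.1 = f.1 \/ e.2 = f.2 -> e = f).

Definition mpartner M m : option (women I) := [pick w | (m, w) \in M].
Definition wpartner M w : option (men I) := [pick m | (m, w) \in M].

Definition blocking M m w : bool :=
  [&& acceptable m w,
      (if mpartner M m is Some w' then prefers (mlist m) w w' else true)
    & (if wpartner M w is Some m' then prefers (wlist w) m m' else true)].

Definition blocking_pairs M : {set men I * women I} :=
  [set e | blocking M e.1 e.2].

Definition feasible M : Prop :=
  (forall m, m \in mstar I -> mpartner M m <> None) /\
  (forall w, w \in wstar I -> wpartner M w <> None).

Definition Delta_men : nat := \max_(m : men I) size (mlist m).
Definition Delta_women : nat := \max_(w : women I) size (wlist w).

Definition smc_size : nat :=
  #|men I| + #|women I|
  + \sum_(m : men I) size (mlist m) + \sum_(w : women I) size (wlist w).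

End Matchings.

(* Programs are systems of first-order recursive functions over binary trees  *)
(* (as in N. D. Jones, Computability and Complexity from a Programming        *)
(* Perspective). Running time is the number of evaluated subexpressions;      *)
(* every primitive handles a bounded number of pointers into a shared heap,   *)
(* so this measure is polynomially related to Turing machine time.            *)
Inductive data := Leaf | Node (a b : data).

(* Variables are de Bruijn indices. [Case e e0 e1] evaluates e0 if e is Leaf, *)
(* and e1 with a, b bound to the variables 0, 1 if e is [Node a b].           *)
Inductive expr :=
  | Var (x : nat)
  | ELeaf
  | ENode (e1 e2 : expr)
  | Let (e1 e2 : expr)
  | Case (e e0 e1 : expr)
  | Call (f : nat) (args : seq expr).

(* The f-th entry is the body of the function f; function 0 is the entry      *)
(* point.                                                                     *)
Definition program := seq expr.

(* [eval p r e v t]: in the environment r, e evaluates to v in t steps.       *)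
Inductive eval (p : program) : seq data -> expr -> data -> nat -> Prop :=
  | eval_Var r x : eval p r (Var x) (nth Leaf r x) 1
  | eval_Leaf r : eval p r ELeaf Leaf 1
  | eval_Node r e1 e2 v1 v2 t1 t2 :
      eval p r e1 v1 t1 -> eval p r e2 v2 t2 ->
      eval p r (ENode e1 e2) (Node v1 v2) (t1 + t2).+1
  | eval_Let r e1 e2 v1 v2 t1 t2 :
      eval p r e1 v1 t1 -> eval p (v1 :: r) e2 v2 t2 ->
      eval p r (Let e1 e2) v2 (t1 + t2).+1
  | eval_CaseLeaf r e e0 e1 v t t0 :
      eval p r e Leaf t -> eval p r e0 v t0 ->
      eval p r (Case e e0 e1) v (t + t0).+1
  | eval_CaseNode r e e0 e1 a b v t t1 :
      eval p r e (Node a b) t -> eval p [:: a, b & r] e1 v t1 ->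
      eval p r (Case e e0 e1) v (t + t1).+1
  | eval_Call r f args vs v t t1 :
      evals p r args vs t -> eval p vs (nth ELeaf p f) v t1 ->
      eval p r (Call f args) v (t + t1).+1
with evals (p : program) : seq data -> seq expr -> seq data -> nat -> Prop :=
  | evals_nil r : evals p r [::] [::] 0
  | evals_cons r e es v vs t ts :
      eval p r e v t -> evals p r es vs ts ->
      evals p r (e :: es) (v :: vs) (t + ts).

Scheme eval_mut := Minimality for eval Sort Prop
  with evals_mut := Minimality for evals Sort Prop.

Definition run (p : program) (input output : data) (t : nat) : Prop :=
  eval p [:: input] (nth ELeaf p 0) output t.

Lemma run_deterministic p i v v' t t' :
  run p i v t -> run p i v' t' -> v = v' /\ t = t'.
Proof.
move=> H; move: v' t'; rewrite /run in H *.
move: H; move: [:: i] (nth ELeaf p 0) v t.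
apply: (@eval_mut p (fun r e v t => forall v' t', eval p r e v' t' ->
   v = v' /\ t = t') (fun r es vs t => forall vs' t', evals p r es vs' t' ->
   vs = vs' /\ t = t')); intros;
  match goal with
  | E : eval _ _ _ ?v ?t |- _ = ?v /\ _ => inversion E
  | E : evals _ _ _ ?v ?t |- _ = ?v /\ _ => inversion E
  end; subst; repeat
  match goal with
  | IH : (forall v' t', eval p ?r ?e v' t' -> _), E : eval p ?r ?e _ _ |- _ =>
      destruct (IH _ _ E); clear E; try discriminate;
      repeat match goal with
      | C : Node _ _ = Node _ _ |- _ => injection C; clear C; intros
      end; subst
  | IH : (forall v' t', evals p ?r ?e v' t' -> _), E : evals p ?r ?e _ _ |- _ =>
      destruct (IH _ _ E); clear E; subst
  end; by [].
Qed.

(* Persons are numbered by their rank in the enumeration of their type, in    *)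
(* unary; since every person contributes to [smc_size], this is polynomially  *)
(* equivalent to binary numbering.                                            *)
Definition enc_nat (n : nat) : data := iter n (Node Leaf) Leaf.
Definition enc_bool (b : bool) : data := if b then Node Leaf Leaf else Leaf.
Definition enc_list (T : Type) (f : T -> data) (s : seq T) : data :=
  foldr (fun x d => Node (f x) d) Leaf s.
Definition enc_elt (T : finType) (x : T) : data := enc_nat (enum_rank x).

Definition enc_man (I : smc) (m : men I) : data :=
  Node (enc_bool (m \in mstar I)) (enc_list (@enc_elt _) (mlist m)).
Definition enc_woman (I : smc) (w : women I) : data :=
  Node (enc_bool (w \in wstar I)) (enc_list (@enc_elt _) (wlist w)).

Definition enc_smc (I : smc) : data :=
  Node (enc_list (@enc_man I) (enum (men I)))
       (enc_list (@enc_woman I) (enum (women I))).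

(* [None] stands for the answer that no feasible matching exists.             *)
Definition enc_output (I : smc) (o : option (seq (men I * women I))) : data :=
  if o is Some s
  then Node Leaf (enc_list (fun e => Node (enc_elt e.1) (enc_elt e.2)) s)
  else Leaf.

(* Main.v *)
Require Import Defs.
From mathcomp Require Import all_boot all_order all_algebra.
From mathcomp Require Import zify.

(* The matching is the outcome of a deferred acceptance procedure with levels. *)
(* A man proposes first at the low levels, where only distinguished women are  *)
(* addressed, then at a middle level to all women, and finally, if he is       *)
(* distinguished, at the high levels to all women; a woman prefers a higher    *)
(* level to a lower one, and uses her own list within a level. If (m, w)       *)
(* blocks the outcome, then w holds a proposal of a higher level than that of  *)
(* m, so the partner of m or the partner of w is distinguished; and the        *)
(* partner of a distinguished person x blocks with at most Delta - 1 persons,  *)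
(* since its list contains x. If a feasible matching N exists, then an         *)
(* uncovered distinguished man starts an alternating path along which the      *)
(* level drops by at most one per step, so that it stays in the high levels    *)
(* for more steps than there are men; dually for women and low levels.         *)

Set Implicit Arguments.
Unset Strict Implicit.
Unset Printing Implicit Defensive.

(** Levels are folded into a numerical key [j * n + rank], where [j = 0] is the top level and
    [j = n] the middle one: a woman minimizes keys, and a man works through his proposals from
    [j = n + q] down to [j = 0]. At a fixed point of [step], two facts determine the outcome: no
    current proposal is beaten ([head_undominated]), and every proposal already given up is beaten
    by the one its addressee now holds ([proposal_dropped]). Quality: by [marriages_blocking], in
    each blocking pair one of the two persons has a distinguished partner. [card_blocking_pairs]
    charges the pair to that partner and counts. Completeness: let [N] be a feasible matching and
    suppose a distinguished person is uncovered. Sets of distinguished persons are cut out by level,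
    and following [N] and then the outcome (dually for women) maps each set injectively into the
    next, missing the uncovered person. Hence the sets grow strictly ([card_growth]). There are as
    many high levels as men and as many low levels as women, so they outgrow the sex
    ([covers_men_complete], [covers_women_complete]). Time: every effective step discards a
    proposal, so polynomially many steps suffice. [call_main] adds up the costs of the routines. *)

Lemma pairwise_index (T : eqType) (s : seq T) :
  uniq s -> pairwise (fun x y => index x s < index y s) s.
Proof.
move=> us; case: s us => [//|x0 s'] us; set s := x0 :: s' in us *.
by apply/(pairwiseP x0) => i j; rewrite !inE => Hi Hj ij; rewrite !index_uniq.
Qed.

(** * Counting blocking pairs by distinguished partners *)

Section Partners.
Variable I : smc.
Implicit Types (M : {set men I * women I}) (m : men I) (w : women I).

Lemma mpartner_mem M m w : mpartner M m = Some w -> (m, w) \in M.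
Proof. by rewrite /mpartner; case: pickP => // w' H [<-]. Qed.

Lemma wpartner_mem M m w : wpartner M w = Some m -> (m, w) \in M.
Proof. by rewrite /wpartner; case: pickP => // m' H [<-]. Qed.

Lemma mem_mpartner M m w :
  is_matching M -> (m, w) \in M -> mpartner M m = Some w.
Proof.
move=> [_ uM] mwM; rewrite /mpartner; case: pickP => [w' H|/(_ w)/negP//].
by have [->] := uM _ _ mwM H (or_introl erefl).
Qed.

Lemma mem_wpartner M m w :
  is_matching M -> (m, w) \in M -> wpartner M w = Some m.
Proof.
move=> [_ uM] mwM; rewrite /wpartner; case: pickP => [m' H|/(_ m)/negP//].
by have [->] := uM _ _ mwM H (or_intror erefl).
Qed.

(* The blocking pairs of [m] exclude the current partner of [m]. *)
Lemma card_blocking_man M m w0 (A : {set women I}) :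
  (m, w0) \in M -> is_matching M ->
  {in A, forall w, blocking M m w} -> #|A| <= (Delta_men I).-1.
Proof.
move=> mw0 Mm Ab; have w0l : w0 \in mlist m by case: Mm => /(_ _ _ mw0)/andP[].
have sA : A \subset [set w in mlist m] :\ w0.
  apply/subsetP => w /Ab /and3P[/andP[wl _]].
  rewrite (mem_mpartner Mm mw0) !inE wl andbT => H _.
  by apply: contraTneq H => ->; rewrite /prefers ltnn.
apply: leq_trans (subset_leq_card sA) _.
have := cardsD1 w0 [set w in mlist m].
rewrite inE w0l add1n cardsE (card_uniqP (mlist_uniq m)) => E.
by rewrite -ltnS -E prednK; apply: leq_trans (leq_bigmax m) => //=; rewrite E.
Qed.

Lemma card_blocking_woman M w m0 (A : {set men I}) :
  (m0, w) \in M -> is_matching M ->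
  {in A, forall m, blocking M m w} -> #|A| <= (Delta_women I).-1.
Proof.
move=> mw0 Mm Ab; have m0l : m0 \in wlist w by case: Mm => /(_ _ _ mw0)/andP[].
have sA : A \subset [set m in wlist w] :\ m0.
  apply/subsetP => m /Ab /and3P[/andP[_ ml] _].
  rewrite (mem_wpartner Mm mw0) !inE ml andbT => H.
  by apply: contraTneq H => ->; rewrite /prefers ltnn.
apply: leq_trans (subset_leq_card sA) _.
have := cardsD1 m0 [set m in wlist w].
rewrite inE m0l add1n cardsE (card_uniqP (wlist_uniq w)) => E.
by rewrite -ltnS -E prednK; apply: leq_trans (leq_bigmax w) => //=; rewrite E.
Qed.

Lemma card_blocking_pairs M :
  is_matching M -> feasible M ->
  (forall m w, blocking M m w ->
     (exists2 w0, w0 \in wstar I & (m, w0) \in M) \/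
     (exists2 m0, m0 \in mstar I & (m0, w) \in M)) ->
  #|blocking_pairs M| <=
    (Delta_women I).-1 * #|mstar I| + (Delta_men I).-1 * #|wstar I|.
Proof.
move=> Mm [fm fw] Mb; pose B := blocking_pairs M.
pose F w0 := [set x in B | mpartner M x.1 == Some w0].
pose G m0 := [set x in B | wpartner M x.2 == Some m0].
have sB : B \subset
    (\bigcup_(m0 in mstar I) G m0) :|: (\bigcup_(w0 in wstar I) F w0).
  apply/subsetP => -[m w] xB; have := xB; rewrite inE => /Mb[[w0 w0s H]|[m0 m0s H]].
    apply/setUP; right; apply/bigcupP; exists w0 => //.
    by rewrite inE xB (mem_mpartner Mm H) eqxx.
  apply/setUP; left; apply/bigcupP; exists m0 => //.
  by rewrite inE xB (mem_wpartner Mm H) eqxx.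
have cup (T : finType) (S : {set T}) (H : T -> {set men I * women I}) c :
    {in S, forall x, #|H x| <= c} -> #|\bigcup_(x in S) H x| <= c * #|S|.
  move=> Hc; rewrite mulnC -sum_nat_const.
  apply: (big_ind2 (fun (A : {set _}) b => #|A| <= b)) => // [|A1 b1 A2 b2 H1 H2].
    by rewrite cards0.
  exact: leq_trans (leq_card_setU _ _) (leq_add H1 H2).
apply: leq_trans (subset_leq_card sB) _; apply: leq_trans (leq_card_setU _ _) _.
apply: leq_add; apply: cup.
- move=> m0 /fm; case E: (mpartner M m0) => [w|//] _; have mw := mpartner_mem E.
  (* All pairs in [G m0] share the woman [w] matched to [m0], so the man determines the pair. *)
  rewrite -[#|G m0|](card_in_imset (f := fst)).
    apply: (card_blocking_woman mw Mm) => m /imsetP[[m1 w1]].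
    rewrite !inE /= => /andP[H /eqP/wpartner_mem/(mem_mpartner Mm)].
    by rewrite E => -[->] ->.
  move=> [m1 w1] [m2 w2]; rewrite !inE /=.
  move=> /andP[_ /eqP/wpartner_mem/(mem_mpartner Mm)] +
    /andP[_ /eqP/wpartner_mem/(mem_mpartner Mm)].
  by rewrite E => -[->] [->] ->.
- move=> w0 /fw; case E: (wpartner M w0) => [m|//] _; have mw := wpartner_mem E.
  rewrite -[#|F w0|](card_in_imset (f := snd)).
    apply: (card_blocking_man mw Mm) => w /imsetP[[m1 w1]].
    rewrite !inE /= => /andP[H /eqP/mpartner_mem/(mem_wpartner Mm)].
    by rewrite E => -[->] ->.
  move=> [m1 w1] [m2 w2]; rewrite !inE /=.
  move=> /andP[_ /eqP/mpartner_mem/(mem_wpartner Mm)] +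
    /andP[_ /eqP/mpartner_mem/(mem_wpartner Mm)].
  by rewrite E => -[->] [->] ->.
Qed.

Lemma feasible_Delta_men M :
  is_matching M -> feasible M -> wstar I != set0 -> 0 < Delta_men I.
Proof.
move=> [aM _] [_ fw] /set0Pn[w /fw]; case E: (wpartner M w) => [m|//] _.
have /andP[wl _] := aM _ _ (wpartner_mem E).
by apply: leq_trans (leq_bigmax m) => /=; case: (mlist m) wl.
Qed.

Lemma feasible_Delta_women M :
  is_matching M -> feasible M -> mstar I != set0 -> 0 < Delta_women I.
Proof.
move=> [aM _] [fm _] /set0Pn[m /fm]; case E: (mpartner M m) => [w|//] _.
have /andP[_ ml] := aM _ _ (mpartner_mem E).
by apply: leq_trans (leq_bigmax w) => /=; case: (wlist w) ml.
Qed.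

(** Truncated and integer predecessors differ only at [d = 0], where the hypothesis forces
    [k = 0]. *)
Lemma predn_mulZ d k :
  (0 < k -> 0 < d) -> (((d.-1 * k)%N)%:Z = (d%:Z - 1) * k%:Z)%R.
Proof. by case: d k => [|d] [|k] // H; rewrite ?mulr0; lia. Qed.

End Partners.

(** The image of [A j] avoids [x0], which lies in [A j.+1], so each step gains an element and [A j]
    has more than [j] of them. *)
Lemma card_growth (T : finType) (A : nat -> {set T}) x0 k :
  (forall j, x0 \in A j) ->
  (forall j, j < k -> exists2 f : T -> T, {in A j &, injective f} &
     {in A j, forall x, f x \in A j.+1 :\ x0}) ->
  k < #|T|.
Proof.
move=> xA fA; suff H j : j <= k -> j < #|A j|.
  exact: leq_trans (H k (leqnn k)) (max_card _).
elim: j => [|j IH] jk; first by apply/card_gt0P; exists x0.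
have [f finj fP] := fA j jk; rewrite (cardsD1 x0) xA // add1n ltnS.
apply: leq_trans (IH (ltnW jk)) _; rewrite -(card_in_imset finj).
by apply/subset_leq_card/subsetP => y /imsetP[x xAj ->]; apply: fP.
Qed.

(** * Levelled proposals and their order *)

Section Proposals.
Variable I : smc.
Implicit Types (m : men I) (w : women I) (e h : women I * nat).
Implicit Type mode : nat.
Local Notation n := #|men I|.
Local Notation q := #|women I|.

(* Modes 0, 1 and 2 are those of the high, middle and low levels. *)
Definition allow mode m w : bool :=
  match mode with
  | 0 => m \in mstar I
  | 1 => true
  | _ => w \in wstar I
  end.

(* A proposal is paired with a key, and women minimize keys: at the j-th level  *)
(* from the top the offset is j * n, which dominates the ranks within a level.  *)
Definition level m off mode : seq (women I * nat) :=
  [seq (w, off + index m (wlist w)) |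
    w <- [seq w <- mlist m | allow mode m w && (m \in wlist w)]].

(** The accumulator puts each level in front of the previous ones, so the list starts with the last,
    hence lowest, level of the schedule. *)
Fixpoint stack_levels m (sched : seq nat) off rest : seq (women I * nat) :=
  if sched is mode :: sched' then
    stack_levels m sched' (n + off) (level m off mode ++ rest)
  else rest.

Definition schedule : seq nat := nseq n 0 ++ 1 :: nseq q 2.
Definition proposals m := stack_levels m schedule 0 [::].

Definition lev e : nat := e.2 %/ n.

Definition proposed_before m e1 e2 : bool :=
  (lev e2 < lev e1) ||
  (lev e1 == lev e2) && (index e1.1 (mlist m) < index e2.1 (mlist m)).

Lemma index_wlist_lt m w : m \in wlist w -> index m (wlist w) < n.
Proof.
by rewrite -index_mem => /leq_trans; apply; rewrite -(card_uniqP (wlist_uniq w)) max_card.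
Qed.

Lemma men_gt0 m : 0 < n.
Proof. by apply/card_gt0P; exists m. Qed.

Lemma mem_level m off mode e :
  reflect [/\ acceptable m e.1, allow mode m e.1
            & e.2 = off + index m (wlist e.1)]
          (e \in level m off mode).
Proof.
apply: (iffP mapP) => [[w]|[/andP[H1 H2] H3 H4]].
  by rewrite mem_filter => /andP[/andP[H1 H2] H3] -> /=; split=> //; apply/andP.
exists e.1; last by rewrite -H4; case: e {H1 H2 H3 H4}.
by rewrite mem_filter H3 H2 H1.
Qed.

Lemma mem_stack_levels m sched off rest e :
  e \in stack_levels m sched off rest <->
  (exists2 j, j < size sched & e \in level m (j * n + off) (nth 0 sched j)) \/
  e \in rest.
Proof.
elim: sched off rest => [|x sc IH] off rest /=.
  by split=> [H|[[j]|]//]; right.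
rewrite IH mem_cat; split.
  case=> [[j jl H]|/orP[H|H]].
  - by left; exists j.+1 => //=; rewrite mulSnr -addnA.
  - by left; exists 0.
  - by right.
case=> [[[|j] /= jl H]|H].
- by right; rewrite H.
- by left; exists j => //; rewrite addnA -mulSnr.
- by right; rewrite H orbT.
Qed.

Lemma size_schedule : size schedule = (n + q).+1.
Proof. by rewrite size_cat /= !size_nseq addnS. Qed.

(** Closed form of the schedule; at [j = n] both guards are void, so every acceptable pair has a
    proposal there. *)
Definition allowed_at j m w : bool :=
  (j <= n + q) && ((j < n) ==> (m \in mstar I)) && ((n < j) ==> (w \in wstar I)).

Lemma mem_proposals m e :
  reflect (exists j, [/\ acceptable m e.1, allowed_at j m e.1
                       & e.2 = j * n + index m (wlist e.1)])
          (e \in proposals m).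
Proof.
have key j : j <= n + q ->
    allow (nth 0 schedule j) m e.1 =
    ((j < n) ==> (m \in mstar I)) && ((n < j) ==> (e.1 \in wstar I)).
  move=> jl; rewrite /schedule nth_cat size_nseq nth_nseq.
  case: (ltngtP j n) => [jn|jn|->] /=; rewrite ?andbT ?subnn //.
  case: (j - n) (subnKC (ltnW jn)) => [|i] ji; first by rewrite -ji addn0 ltnn in jn.
  by rewrite /= nth_nseq -(ltn_add2l n) -ltnS -addnS ji ltnS jl.
apply: (iffP idP) => [/mem_stack_levels[[j]|//]|[j [H1 H2 H3]]].
  rewrite size_schedule addn0 => jl /mem_level[H1 H2 H3]; exists j; split=> //.
  by rewrite /allowed_at -andbA -key // H2 andbT.
apply/mem_stack_levels; left; move: H2; rewrite /allowed_at -andbA => /andP[H4].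
rewrite -key // => H5; exists j; first by rewrite size_schedule.
by apply/mem_level; rewrite addn0.
Qed.

Lemma lev_key j m w : m \in wlist w -> lev (w, j * n + index m (wlist w)) = j.
Proof.
move=> /index_wlist_lt H; rewrite /lev /= divnMDl ?divn_small ?addn0 //.
exact: men_gt0 m.
Qed.

Lemma mem_proposals_lev m e :
  e \in proposals m ->
  [/\ acceptable m e.1, allowed_at (lev e) m e.1
    & e.2 = lev e * n + index m (wlist e.1)].
Proof.
case: e => w k /mem_proposals[j /= [H1 H2 ->]].
by case/andP: (H1) => _ H3; rewrite lev_key.
Qed.

Lemma pairwise_level m j mode : pairwise (proposed_before m) (level m (j * n) mode).
Proof.
rewrite /level pairwise_map.
have : pairwise (fun w1 w2 => index w1 (mlist m) < index w2 (mlist m))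
         [seq w <- mlist m | allow mode m w && (m \in wlist w)].
  by rewrite (subseq_pairwise (filter_subseq _ _)) // pairwise_index // mlist_uniq.
apply: (sub_in_pairwise (P := fun w => m \in wlist w)).
  move=> w1 w2 H1 H2 /= H; rewrite /proposed_before.
  by rewrite !lev_key // eqxx H orbT.
by apply/allP => w; rewrite mem_filter => /andP[/andP[]].
Qed.

Lemma pairwise_stack_levels m sched j rest :
  (forall e, e \in rest -> lev e < j) ->
  pairwise (proposed_before m) rest ->
  pairwise (proposed_before m) (stack_levels m sched (j * n) rest).
Proof.
elim: sched j rest => [//|x sc IH] j rest Hr Pr /=.
have lv e : e \in level m (j * n) x -> lev e = j.
  case: e => w k /mem_level[/= /andP[_ H] _ ->]; exact: lev_key.
rewrite -mulSn; apply: IH => [e|].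
  by rewrite mem_cat => /orP[/lv->|/Hr/ltnW].
rewrite pairwise_cat Pr pairwise_level !andbT; apply/allrelP => e1 e2 /lv H1 /Hr H2.
by rewrite /proposed_before H1 H2.
Qed.

Lemma pairwise_proposals m : pairwise (proposed_before m) (proposals m).
Proof. by apply: (@pairwise_stack_levels m schedule 0). Qed.

Lemma size_stack_levels m sched off rest :
  size (stack_levels m sched off rest) <=
  size sched * size (mlist m) + size rest.
Proof.
elim: sched off rest => [//|x sc IH] off rest /=.
apply: leq_trans (IH _ _) _; rewrite size_cat size_map size_filter.
have := count_size (fun w => allow x m w && (m \in wlist w)) (mlist m); lia.
Qed.

Lemma size_proposals m : size (proposals m) <= (n + q).+1 * size (mlist m).
Proof.
by have := size_stack_levels m schedule 0 [::]; rewrite size_schedule addn0.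
Qed.

Lemma key_proposals m e : e \in proposals m -> e.2 < (n + q).+1 * n.
Proof.
move=> /mem_proposals_lev[/andP[_ H1] /andP[/andP[H2 _] _] ->].
have := index_wlist_lt H1; nia.
Qed.

(** * Deferred acceptance as simultaneous rejection *)

Definition state := {ffun men I -> seq (women I * nat)}.
Implicit Type s : state.

Definition beats (l : seq (women I * nat)) e : bool :=
  if l is h :: _ then (h.1 == e.1) && (h.2 < e.2) else false.

Definition dominated s e : bool := has (fun m => beats (s m) e) (enum (men I)).

Definition reject s (l : seq (women I * nat)) : seq (women I * nat) :=
  if l is e :: l' then (if dominated s e then l' else l) else [::].

Definition step s : state := [ffun m => reject s (s m)].

Definition init_state : state := [ffun m => proposals m].

Definition fuel : nat := \sum_(m : men I) size (proposals m).

Definition final_state : state := iter fuel step init_state.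

(** The invariant of the procedure: discarded proposals are beaten in the current state, not merely
    when they were discarded. *)
Definition dominated_outside s : Prop :=
  forall m, exists2 d, proposals m = d ++ s m & {in d, forall e, dominated s e}.

Lemma dominatedP s e :
  reflect (exists m h, [/\ ohead (s m) = Some h, h.1 = e.1 & h.2 < e.2])
          (dominated s e).
Proof.
apply: (iffP hasP) => [[m _]|[m [h [H1 H2 H3]]]].
  rewrite /beats; case E: (s m) => [//|h l] /andP[/eqP H1 H2].
  by exists m, h; rewrite E.
exists m; rewrite ?mem_enum // /beats.
by case: (s m) H1 => [//|h' l] [->]; rewrite H2 eqxx.
Qed.

(* The best proposal received by a woman survives a step. *)
Lemma dominated_step s e : dominated s e -> dominated (step s) e.
Proof.
case/dominatedP => m0 [h0 [H1 H2 H3]].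
pose ishead k := [exists m, ohead (s m) == Some (e.1, k)].
have ex : exists k, ishead k.
  by exists h0.2; apply/existsP; exists m0; rewrite H1 -H2; case: (h0).
case: (ex_minnP ex) => k /existsP[m /eqP Hm] kmin.
apply/dominatedP; exists m, (e.1, k); split=> //.
  rewrite ffunE; case E: (s m) Hm => [//|h l] [hE] /=.
  case: ifP; rewrite ?hE // => /dominatedP[m' [h' [Hm' /= h'1 h'2]]].
  suff /kmin : ishead h'.2 by lia.
  by apply/existsP; exists m'; rewrite Hm' -h'1; case: (h').
apply: leq_trans H3; apply: kmin; apply/existsP; exists m0.
by rewrite H1 -H2; case: (h0).
Qed.

Lemma dominated_outside_step s : dominated_outside s -> dominated_outside (step s).
Proof.
move=> H m; have [d Ed Hd] := H m; rewrite ffunE.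
case E: (s m) => [|e l] /=.
  by exists d; rewrite ?Ed ?E // => e /Hd /dominated_step.
case: ifP => D; last first.
  by exists d; rewrite ?Ed ?E // => e' /Hd /dominated_step.
exists (rcons d e); first by rewrite Ed E cat_rcons.
move=> e'; rewrite mem_rcons inE => /predU1P[->|/Hd]; exact: dominated_step.
Qed.

Lemma dominated_outside_iter k : dominated_outside (iter k step init_state).
Proof.
elim: k => [|k IH]; last exact: dominated_outside_step.
by move=> m; exists [::]; rewrite ?ffunE.
Qed.

Lemma size_reject s l : size (reject s l) <= size l.
Proof. by case: l => [//|e l] /=; case: ifP. Qed.

(** A step that changes the state shortens some list and lengthens none, so the total length bounds
    the number of effective steps. *)
Lemma iter_step_fixed k s :
  \sum_(m : men I) size (s m) <= k -> step (iter k step s) = iter k step s.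
Proof.
elim: k s => [|k IH] s Hs.
  apply/ffunP => m; rewrite ffunE /=.
  have : size (s m) = 0 by move: Hs; rewrite (bigD1 m) //=; lia.
  by case: (s m).
case: (eqVneq (step s) s) => [fx|nfx]; first by rewrite iter_fix.
rewrite iterSr; apply: IH; rewrite -ltnS; apply: leq_trans Hs.
have [m Hm] : exists m, step s m != s m.
  by apply/existsP; apply: contraNT nfx => /existsPn H;
    apply/eqP/ffunP => m; apply/eqP/negPn/H.
rewrite [X in X < _](bigD1 m) // [X in _ < X](bigD1 m) //= -addSn leq_add //.
  move: Hm; rewrite ffunE; case: (s m) => [//|e l] /=.
  by case: ifP => //; rewrite eqxx.
by apply: leq_sum => m' _; rewrite ffunE size_reject.
Qed.

Lemma final_state_fixed : step final_state = final_state.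
Proof. by apply: iter_step_fixed; apply: leq_sum => m _; rewrite ffunE. Qed.

(** * The outcome: matching, blocking pairs and completeness *)

Definition marriages s (r : seq (men I)) : seq (men I * women I) :=
  pmap (fun m => omap (fun h => (m, h.1)) (ohead (s m))) r.

Definition covers_men s : bool :=
  all (fun m => (m \in mstar I) ==> (s m != [::])) (enum (men I)).

Definition proposed_to s w : bool :=
  has (fun m => if s m is h :: _ then h.1 == w else false) (enum (men I)).

Definition covers_women s : bool :=
  all (fun w => (w \in wstar I) ==> proposed_to s w) (enum (women I)).

Section Outcome.
Variable s : state.
Hypothesis s_dom : dominated_outside s.
Hypothesis s_fix : step s = s.

Let M : {set men I * women I} := [set e in marriages s (enum (men I))].

Lemma mem_marriages m w :
  reflect (exists2 h, ohead (s m) = Some h & h.1 = w) ((m, w) \in M).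
Proof.
rewrite inE mem_pmap; apply: (iffP mapP) => [[m' _]|[h H1 H2]].
  by case E: (ohead (s m')) => [h|//] [-> ->]; exists h.
by exists m; rewrite ?mem_enum // H1 /= H2.
Qed.

Lemma head_proposals m h : ohead (s m) = Some h -> h \in proposals m.
Proof.
have [d -> _] := s_dom m; case: (s m) => [//|h' l] [->].
by rewrite mem_cat inE eqxx orbT.
Qed.

Lemma head_undominated m h : ohead (s m) = Some h -> ~~ dominated s h.
Proof.
move/ffunP/(_ m): s_fix; rewrite ffunE; case: (s m) => [//|h' l] /= + [<-].
by case: ifP => // _ /(congr1 size) /=; lia.
Qed.

(** Lists are sorted by [proposed_before], so a proposal that is neither the head nor after it lies
    in the discarded prefix, where the invariant applies. If the list is exhausted, this covers
    every proposal of [m]. *)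
Lemma proposal_dropped m e :
  e \in proposals m ->
  (forall h, ohead (s m) = Some h -> e != h /\ ~~ proposed_before m h e) ->
  exists m' h, [/\ ohead (s m') = Some h, h.1 = e.1 & h.2 < e.2].
Proof.
move=> em H; apply/dominatedP; have [d Ed Hd] := s_dom m.
move: em; rewrite Ed mem_cat => /orP[/Hd//|].
move: (pairwise_proposals m) H; rewrite Ed.
case: (s m) => [//|h l]; rewrite pairwise_cat => /and3P[_ _ /= /andP[/allP Hl _]].
move=> /(_ h erefl)[/negPf]; rewrite inE => -> /= nb /Hl.
by rewrite (negPf nb).
Qed.

(** Two unbeaten proposals to one woman have equal keys, and a key determines the rank of its man in
    her list. *)
Lemma head_inj m1 m2 h1 h2 :
  ohead (s m1) = Some h1 -> ohead (s m2) = Some h2 -> h1.1 = h2.1 ->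
  m1 = m2 /\ h1 = h2.
Proof.
move=> H1 H2 e1.
have U1 := head_undominated H1; have U2 := head_undominated H2.
have e2 : h1.2 = h2.2.
  case: (ltngtP h1.2 h2.2) => // H.
  - by case/negP: U2; apply/dominatedP; exists m1, h1.
  - by case/negP: U1; apply/dominatedP; exists m2, h2.
have eh : h1 = h2 by case: h1 h2 e1 e2 {H1 H2 U1 U2} => [? ?] [? ?] /= -> ->.
split=> //; rewrite -{}eh in H2 => {h2 e1 e2 U2}.
have [/andP[_ I1] _ E1] := mem_proposals_lev (head_proposals H1).
have [/andP[_ I2] _ E2] := mem_proposals_lev (head_proposals H2).
have := E1; rewrite E2 => /addnI E.
by rewrite -(nth_index m1 I1) -E nth_index.
Qed.

Lemma marriages_matching : is_matching M.
Proof.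
split=> [m w /mem_marriages[h H <-]|[m1 w1] [m2 w2]].
  by have [] := mem_proposals_lev (head_proposals H).
move=> /mem_marriages[h1 H1 E1] /mem_marriages[h2 H2 E2] /= [E|E].
  by move: E1 E2 H2; rewrite -E H1 => <- <- [->].
have E3 : h1.1 = h2.1 by rewrite E1 E2.
by have [-> _] := head_inj H1 H2 E3; rewrite E.
Qed.

Lemma marriages_feasible : feasible M <-> covers_men s && covers_women s.
Proof.
have Mm := marriages_matching; split=> [[fm fw]|/andP[/allP cm /allP cw]].
  apply/andP; split; apply/allP => x _; apply/implyP.
    move=> /fm; case E: (mpartner M x) => [w|//] _.
    by have /mem_marriages[h] := mpartner_mem E; case: (s x).
  move=> /fw; case E: (wpartner M x) => [m|//] _.
  have /mem_marriages[h H1 H2] := wpartner_mem E.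
  by apply/hasP; exists m; rewrite ?mem_enum //; case: (s m) H1 => // ? ? [->]; apply/eqP.
split=> [m ms|w ws].
  have := cm m; rewrite mem_enum ms => /(_ isT); case E: (s m) => [//|h l] _.
  have : (m, h.1) \in M by apply/mem_marriages; exists h; rewrite ?E.
  by move/(mem_mpartner Mm) => ->.
have := cw w; rewrite mem_enum ws => /(_ isT) /hasP[m _]; case E: (s m) => [//|h l] /eqP hw.
have : (m, w) \in M by apply/mem_marriages; exists h; rewrite ?E.
by move/(mem_wpartner Mm) => ->.
Qed.

Lemma marriages_blocking m w :
  blocking M m w ->
  (exists2 w0, w0 \in wstar I & (m, w0) \in M) \/
  (exists2 m0, m0 \in mstar I & (m0, w) \in M).
Proof.
have Mm := marriages_matching.
case/and3P => ac bm bw; case/andP: (ac) => _ mw.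
(* A man without a head has exhausted all levels; [n] selects the middle one, where no woman is
   barred to him. *)
pose j := if ohead (s m) is Some h then lev h else n.
case: (leqP j n) => jn; last first.
  left; move: jn; rewrite /j; case E: (ohead (s m)) => [h|]; last by rewrite ltnn.
  have [_ /andP[_ al] _] := mem_proposals_lev (head_proposals E).
  move=> nh; exists h.1; first by rewrite nh in al.
  by apply/mem_marriages; exists h.
right; pose e := (w, j * n + index m (wlist w)).
have ej : lev e = j by apply: lev_key.
have eP : e \in proposals m.
  apply/mem_proposals; exists j; split=> //; rewrite /allowed_at.
  rewrite (leq_trans jn (leq_addr _ _)) (ltnNge n j) jn andbT /=.
  apply/implyP; move: jn; rewrite /j; case E: (ohead (s m)) => [h|]; last by rewrite ltnn.
  have [_ /andP[/andP[_ al] _] _] := mem_proposals_lev (head_proposals E).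
  by move=> _ lh; rewrite lh in al.
have [|m' [h' [H1 H2 H3]]] := proposal_dropped eP.
  move=> h Hh; have mh : (m, h.1) \in M by apply/mem_marriages; exists h.
  move: bm; rewrite (mem_mpartner Mm mh) /prefers => bm; split.
    by apply: contraTneq bm => <-; rewrite ltnn.
  by rewrite /proposed_before ej /j Hh ltnn eqxx /= -leqNgt ltnW.
have m'w : (m', w) \in M by apply/mem_marriages; exists h'.
exists m' => //.
have [/andP[_ m'l] /andP[/andP[_ al] _] E'] := mem_proposals_lev (head_proposals H1).
have lh : lev h' <= j by rewrite -ej /lev leq_div2r // ltnW.
move: bw; rewrite (mem_wpartner Mm m'w) /prefers => bw.
(* A holder at a high level is distinguished. Otherwise both proposals are at the middle level, so
   the keys compare ranks in the list of [w], contradicting [bw]. *)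
move: al; case: ltnP => //= nh.
have jE : lev h' = j by apply/eqP; rewrite eqn_leq lh (leq_trans jn nh).
by move: H3; rewrite E' jE H2 /= ltn_add2l ltnNge (ltnW bw).
Qed.

Lemma covers_men_complete (N : {set men I * women I}) :
  is_matching N -> feasible N -> covers_men s.
Proof.
move=> Nm [fm _]; apply/allP => m0 _; apply/implyP => m0s; apply/negP => /eqP m00.
(* These men have used up level [j]: they are unmatched or propose at a smaller level index. *)
pose A j := [set m in mstar I | if ohead (s m) is Some h then h.2 < j * n else true].
suff : n < n by rewrite ltnn.
have m0A j : m0 \in A j by rewrite inE m0s m00.
apply: (@card_growth _ A m0) => // j jn.
(* From [m] to his partner in [N], then to the man she holds in [M]; the default is never reached on
   [A j]. *)
pose f m := odflt m (obind (wpartner M) (mpartner N m)).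
have fP m : m \in A j -> exists w h,
    [/\ (m, w) \in N, ohead (s (f m)) = Some h, h.1 = w & h.2 < j.+1 * n].
  rewrite inE => /andP[ms Hm]; have := fm m ms.
  case E: (mpartner N m) => [w|//] _; have mwN := mpartner_mem E.
  have [aN _] := Nm; have ac := aN _ _ mwN; have /andP[_ mw] := ac.
  pose e := (w, j * n + index m (wlist w)).
  have eP : e \in proposals m.
    apply/mem_proposals; exists j; split=> //; rewrite /allowed_at ms implybT.
    by rewrite (leq_trans (ltnW jn) (leq_addr _ _)) (ltnNge n j) (ltnW jn).
  have [|m' [h [H1 H2 H3]]] := proposal_dropped eP.
    move=> h Hh; rewrite Hh in Hm; split.
      by apply: contraTneq Hm => <-; rewrite -leqNgt leq_addr.
    have lh : lev h < j by rewrite /lev ltn_divLR // (men_gt0 m).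
    have le : lev e = j by apply: lev_key.
    by rewrite /proposed_before le negb_or -leqNgt (ltnW lh) negb_and neq_ltn lh.
  exists w, h; split=> //.
    have m'w : (m', w) \in M by apply/mem_marriages; exists h.
    by rewrite /f E /= (mem_wpartner marriages_matching m'w).
  by rewrite mulSnr; apply: leq_trans H3 _; rewrite /= leq_add2l ltnW // index_wlist_lt.
exists f.
  move=> m1 m2 /fP[w1 [h1 [N1 H1 E1 _]]] /fP[w2 [h2 [N2 H2 E2 _]]] ff.
  move: H1; rewrite ff H2 => -[eh]; rewrite -{}eh in E1.
  by have [_ uN] := Nm; have [] := uN _ _ N1 N2 (or_intror (etrans (esym E1) E2)).
move=> m /fP[w [h [_ Hf hw hk]]]; rewrite !inE Hf hk andbT; apply/andP; split.
  by apply: contra_eq_neq Hf => ->; rewrite m00.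
have [_ /andP[/andP[_ /implyP al] _] _] := mem_proposals_lev (head_proposals Hf).
apply: al; rewrite /lev ltn_divLR ?(men_gt0 m) //; apply: leq_trans hk _.
by rewrite leq_mul2r jn orbT.
Qed.

Lemma covers_women_complete (N : {set men I * women I}) :
  is_matching N -> feasible N -> covers_women s.
Proof.
move=> Nm [_ fw]; apply/allP => w0 _; apply/implyP => w0s; apply/negPn/negP => np.
have w00 m h : ohead (s m) = Some h -> h.1 != w0.
  move=> H; apply: contraNneq np => hw; apply/hasP; exists m; rewrite ?mem_enum //.
  by case: (s m) H => // ? ? [->]; apply/eqP.
(* For [j = 0] the threshold exceeds every level index, which leaves only women without a proposal.
   In general, nothing held by a woman of [B j] beats a proposal at level [n + q - j]. *)
pose B j := [set w in wstar I | [forall m, if ohead (s m) is Some h then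
                    (h.1 == w) ==> ((n + q).+1 - j <= lev h) else true]].
have w0B j : w0 \in B j.
  rewrite inE w0s; apply/forallP => m; case E: (ohead (s m)) => [h|//].
  by rewrite (negPf (w00 m h E)).
suff : q < q by rewrite ltnn.
apply: (@card_growth _ B w0) => // j jq.
pose g w := odflt w (obind (mpartner M) (wpartner N w)).
have gP w : w \in B j -> exists m h,
    [/\ (m, w) \in N, ohead (s m) = Some h, h.1 = g w & (n + q) - j <= lev h].
  rewrite inE => /andP[ws /forallP Hw]; have := fw w ws.
  case E: (wpartner N w) => [m|//] _; have mwN := wpartner_mem E.
  have [aN _] := Nm; have ac := aN _ _ mwN; have /andP[_ mw] := ac.
  pose e := (w, (n + q - j) * n + index m (wlist w)).
  have le : lev e = n + q - j by apply: lev_key.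
  have eP : e \in proposals m.
    apply/mem_proposals; exists (n + q - j); split=> //.
    by rewrite /allowed_at ws implybT leq_subr andbT -addnBA ?(ltnW jq) // ltnNge leq_addr.
  (* So the partner of [w] in [N] has not been rejected at this level, and his head has at least
     this level index. *)
  have nd : ~ exists m' h, [/\ ohead (s m') = Some h, h.1 = e.1 & h.2 < e.2].
    move=> [m' [h [H1 H2 H3]]]; have := Hw m'; rewrite H1 H2 eqxx /=.
    rewrite subSn; last by apply: leq_trans (ltnW jq) (leq_addl _ _).
    by rewrite -le ltnNge /lev leq_div2r // ltnW.
  case Eh: (ohead (s m)) => [h|]; last by case: nd; apply: (proposal_dropped eP); rewrite Eh.
  exists m, h; split=> //.
    have mh : (m, h.1) \in M by apply/mem_marriages; exists h.
    by rewrite /g E /= (mem_mpartner marriages_matching mh).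
  rewrite -le leqNgt; apply/negP => lh; apply: nd; apply: (proposal_dropped eP).
  rewrite Eh => h' [<-]; split.
    by apply: contraTneq lh => ->; rewrite ltnn.
  by rewrite /proposed_before negb_or -leqNgt (ltnW lh) negb_and neq_ltn lh.
exists g.
  move=> w1 w2 /gP[m1 [h1 [N1 H1 E1 _]]] /gP[m2 [h2 [N2 H2 E2 _]]] gg.
  have [em _] : m1 = m2 /\ h1 = h2 by apply: head_inj; rewrite // E1 E2.
  by have [_ uN] := Nm; have [] := uN _ _ N1 N2 (or_introl em).
move=> w /gP[m [h [_ H hg hl]]]; rewrite !inE -hg (w00 _ _ H) /=.
have [_ /andP[_ /implyP al] _] := mem_proposals_lev (head_proposals H).
(* As [j < q], the level index [n + q - j] is above [n], where only distinguished women are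
   addressed. *)
rewrite al; last first.
  by apply: leq_trans hl; rewrite -addnBA ?(ltnW jq) // -addn1 leq_add2l subn_gt0.
apply/forallP => m'; case E: (ohead (s m')) => [h'|//]; apply/implyP => /eqP hh.
by have [_ ->] := head_inj E H hh; rewrite subSS.
Qed.

End Outcome.

Lemma dominated_outside_final : dominated_outside final_state.
Proof. exact: dominated_outside_iter. Qed.

Lemma iter_step_subset k m e : e \in iter k step init_state m -> e \in proposals m.
Proof.
by have [d -> _] := dominated_outside_iter k m; rewrite mem_cat => ->; rewrite orbT.
Qed.

Definition solution : option (seq (men I * women I)) :=
  if covers_men final_state && covers_women final_state
  then Some (marriages final_state (enum (men I))) else None.

Lemma solution_correct :
  match solution with
  | Some r =>
      let M := [set e in r] in
      [/\ is_matching M, feasible M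
        & (#|blocking_pairs M|%:Z <=
             ((Delta_women I)%:Z - 1) * #|mstar I|%:Z
             + ((Delta_men I)%:Z - 1) * #|wstar I|%:Z)%R]
  | None => ~ exists M : {set men I * women I}, is_matching M /\ feasible M
  end.
Proof.
have sd := dominated_outside_final; have sf := final_state_fixed.
have Mm := marriages_matching sd sf; have Mf := marriages_feasible sd sf.
rewrite /solution; case: ifP => cov /=; last first.
  case=> N [Nm Nf]; move/negP: cov; apply.
  by rewrite (covers_men_complete sd sf Nm Nf) (covers_women_complete sd sf Nm Nf).
have {}Mf := iffRL Mf cov; split=> //.
rewrite -!predn_mulZ ?card_gt0.
- exact: card_blocking_pairs (marriages_blocking sd sf).
- exact: feasible_Delta_men Mm Mf.
- exact: feasible_Delta_women Mm Mf.
Qed.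

End Proposals.

(** * The program *)

Definition f_lt := 1.
Definition f_eq := 2.
Definition f_nth := 3.
Definition f_find := 4.
Definition f_pad := 5.
Definition f_allow := 6.
Definition f_level := 7.
Definition f_stack := 8.
Definition f_init := 9.
Definition f_dom := 10.
Definition f_step := 11.
Definition f_flat := 12.
Definition f_iter := 13.
Definition f_prop := 14.
Definition f_checkm := 15.
Definition f_checkw := 16.
Definition f_out := 17.

Definition ETrue := ENode ELeaf ELeaf.
Definition ESucc e := ENode ELeaf e.

(* The comments give the environment, variable 0 first: above a body that of    *)
(* its arguments, inside a body that of the next expression.                    *)

(* a b *)
Definition lt_body :=
  Case (Var 1) ELeaf
  (Case (Var 2) ETrue (Call f_lt [:: Var 1; Var 3])).

(* a b *)
Definition eq_body :=
  Case (Var 0) (Case (Var 1) ETrue ELeaf)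
  (Case (Var 3) ELeaf (Call f_eq [:: Var 3; Var 1])).

(* i l *)
Definition nth_body :=
  Case (Var 0) (Case (Var 1) ELeaf (Var 0))
  (Case (Var 3) ELeaf (Call f_nth [:: Var 3; Var 1])).

(* x l acc: [Leaf] if x is not in l, and otherwise the successor of acc plus  *)
(* the index of x in l.                                                       *)
Definition find_body :=
  Case (Var 1) ELeaf (* y l' x l acc *)
  (Case (Call f_eq [:: Var 2; Var 0])
     (Call f_find [:: Var 2; Var 1; ESucc (Var 4)])
     (ESucc (Var 6))).

(* l x rest *)
Definition pad_body :=
  Case (Var 0) (Var 2) (* y l' l x rest *)
  (ENode (Var 3) (Call f_pad [:: Var 1; Var 3; Var 4])).

(* mode mstar wstar *)
Definition allow_body :=
  Case (Var 0) (Var 1) (Case (Var 1) ETrue (Var 6)).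

(* i mstar mlist women off mode rest *)
Definition level_body :=
  Case (Var 2) (Var 6) (* w mlist' i mstar mlist women off mode rest *)
  (Let (Call f_level [:: Var 2; Var 3; Var 1; Var 5; Var 6; Var 7; Var 8])
  (* res w mlist' i mstar mlist women off mode rest *)
  (Case (Call f_nth [:: Var 1; Var 6]) ELeaf
  (* wstar wlist res w mlist' i mstar mlist women off mode rest *)
  (Case (Call f_allow [:: Var 10; Var 6; Var 0]) (Var 2)
  (* _ _ wstar wlist res w mlist' i mstar mlist women off mode rest *)
  (Case (Call f_find [:: Var 7; Var 3; Var 11]) (Var 4)
  (* _ key _ _ wstar wlist res w mlist' i mstar mlist women off mode rest *)
  (ENode (ENode (Var 7) (Var 1)) (Var 6)))))).

(* sched i mstar mlist men women off rest *)
Definition stack_body :=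
  Case (Var 0) (Var 7) (* mode sched' sched i mstar mlist men women off rest *)
  (Call f_stack [:: Var 1; Var 3; Var 4; Var 5; Var 6; Var 7;
     Call f_pad [:: Var 6; ELeaf; Var 8];
     Call f_level [:: Var 3; Var 4; Var 5; Var 7; Var 8; Var 0; Var 9]]).

(* ms i men women sched *)
Definition init_body :=
  Case (Var 0) ELeaf (* m ms' ms i men women sched *)
  (Case (Var 0) ELeaf (* mstar mlist m ms' ms i men women sched *)
  (ENode
    (Call f_stack
       [:: Var 8; Var 5; Var 0; Var 1; Var 6; Var 7; ELeaf; ELeaf])
    (Call f_init [:: Var 3; ESucc (Var 5); Var 6; Var 7; Var 8]))).

(* w k s *)
Definition dom_body :=
  Case (Var 2) ELeaf (* l s' w k s *)
  (Case (Var 0) (Call f_dom [:: Var 2; Var 3; Var 1]) (* h l' l s' w k s *)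
  (Case (Var 0) ELeaf (* w' k' h l' l s' w k s *)
  (Case (Call f_eq [:: Var 0; Var 6]) (Call f_dom [:: Var 6; Var 7; Var 5])
  (* _ _ w' k' h l' l s' w k s *)
  (Case (Call f_lt [:: Var 3; Var 9]) (Call f_dom [:: Var 8; Var 9; Var 7])
   ETrue)))).

(* r s *)
Definition step_body :=
  Case (Var 0) ELeaf (* l r' r s *)
  (ENode
    (Case (Var 0) ELeaf (* e l' l r' r s *)
    (Case (Var 0) ELeaf (* w k e l' l r' r s *)
    (Case (Call f_dom [:: Var 0; Var 1; Var 7]) (Var 4) (Var 5))))
    (Call f_step [:: Var 1; Var 3])).

(* s *)
Definition flat_body :=
  Case (Var 0) ELeaf
  (Call f_pad [:: Var 0; ELeaf; Call f_flat [:: Var 1]]).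

(* fuel s *)
Definition iter_body :=
  Case (Var 0) (Var 1)
  (Call f_iter [:: Var 1; Call f_step [:: Var 3; Var 3]]).

(* w s *)
Definition prop_body :=
  Case (Var 1) ELeaf (* l s' w s *)
  (Case (Var 0) (Call f_prop [:: Var 2; Var 1]) (* h l' l s' w s *)
  (Case (Var 0) ELeaf (* w' k' h l' l s' w s *)
  (Case (Call f_eq [:: Var 0; Var 6]) (Call f_prop [:: Var 6; Var 5]) ETrue))).

(* ms s *)
Definition checkm_body :=
  Case (Var 0) ETrue (* m ms' ms s *)
  (Case (Var 3) ELeaf (* l s' m ms' ms s *)
  (Case (Var 2) ELeaf (* mstar mlist l s' m ms' ms s *)
  (Case (Var 0) (Call f_checkm [:: Var 5; Var 3])
  (* _ _ mstar mlist l s' m ms' ms s *)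
  (Case (Var 4) ELeaf (Call f_checkm [:: Var 9; Var 7]))))).

(* ws j s *)
Definition checkw_body :=
  Case (Var 0) ETrue (* w ws' ws j s *)
  (Case (Var 0) ELeaf (* wstar wlist w ws' ws j s *)
  (Case (Var 0) (Call f_checkw [:: Var 3; ESucc (Var 5); Var 6])
  (* _ _ wstar wlist w ws' ws j s *)
  (Case (Call f_prop [:: Var 7; Var 8]) ELeaf
  (Call f_checkw [:: Var 7; ESucc (Var 9); Var 10])))).

(* s i *)
Definition out_body :=
  Case (Var 0) ELeaf (* l s' s i *)
  (Let (Call f_out [:: Var 1; ESucc (Var 3)]) (* res l s' s i *)
  (Case (Var 1) (Var 0) (* h l' res l s' s i *)
  (Case (Var 0) ELeaf (* w k h l' res l s' s i *)
  (ENode (ENode (Var 8) (Var 0)) (Var 4))))).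

Definition main_body :=
  Case (Var 0) ELeaf (* men women input *)
  (Let (Call f_pad [:: Var 0; ELeaf;
          ENode ETrue (Call f_pad [:: Var 1; ESucc ETrue; ELeaf])])
  (* sched men women input *)
  (Let (Call f_init [:: Var 1; ELeaf; Var 1; Var 2; Var 0])
  (* s0 sched men women input *)
  (Let (Call f_iter [:: Call f_flat [:: Var 0]; Var 0])
  (* s s0 sched men women input *)
  (Case (Call f_checkm [:: Var 3; Var 0]) ELeaf
  (* _ _ s s0 sched men women input *)
  (Case (Call f_checkw [:: Var 6; ELeaf; Var 2]) ELeaf
  (ENode ELeaf (Call f_out [:: Var 4; ELeaf]))))))).

Definition prog : program :=
  [:: main_body; lt_body; eq_body; nth_body; find_body; pad_body; allow_body;
      level_body; stack_body; init_body; dom_body; step_body; flat_body;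
      iter_body; prop_body; checkm_body; checkw_body; out_body].

(** * Evaluation with time bounds, and symbolic execution *)

Definition evalb r e v T : Prop := exists2 t, t <= T & eval prog r e v t.
Definition evalsb r es vs T : Prop := exists2 t, t <= T & evals prog r es vs t.
Definition callb f vs v T : Prop := evalb vs (nth ELeaf prog f) v T.

Lemma evalb_le r e v T T' : evalb r e v T -> T <= T' -> evalb r e v T'.
Proof. by move=> [t tT H] TT; exists t => //; apply: leq_trans TT. Qed.

Lemma callb_le f vs v T T' : callb f vs v T -> T <= T' -> callb f vs v T'.
Proof. exact: evalb_le. Qed.

Lemma evalb_Var r x : evalb r (Var x) (nth Leaf r x) 1.
Proof. by exists 1 => //; constructor. Qed.

Lemma evalb_Leaf r : evalb r ELeaf Leaf 1.
Proof. by exists 1 => //; constructor. Qed.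

Lemma evalb_Node r e1 e2 v1 v2 T1 T2 :
  evalb r e1 v1 T1 -> evalb r e2 v2 T2 ->
  evalb r (ENode e1 e2) (Node v1 v2) (T1 + T2).+1.
Proof.
move=> [t1 H1 E1] [t2 H2 E2]; exists (t1 + t2).+1; last exact: eval_Node.
by rewrite ltnS leq_add.
Qed.

Lemma evalb_Let r e1 e2 v1 v2 T1 T2 :
  evalb r e1 v1 T1 -> evalb (v1 :: r) e2 v2 T2 ->
  evalb r (Let e1 e2) v2 (T1 + T2).+1.
Proof.
move=> [t1 H1 E1] [t2 H2 E2]; exists (t1 + t2).+1; last exact: eval_Let E2.
by rewrite ltnS leq_add.
Qed.

Lemma evalb_Case r e e0 e1 d v T T1 :
  evalb r e d T ->
  match d with
  | Leaf => evalb r e0 v T1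
  | Node a b => evalb [:: a, b & r] e1 v T1
  end ->
  evalb r (Case e e0 e1) v (T + T1).+1.
Proof.
move=> [t H E]; case: d E => [|a b] E [t1 H1 E1]; exists (t + t1).+1;
  rewrite ?ltnS ?leq_add //.
- exact: eval_CaseLeaf.
- exact: eval_CaseNode E1.
Qed.

Lemma evalb_CaseVar r x e0 e1 v T1 :
  match nth Leaf r x with
  | Leaf => evalb r e0 v T1
  | Node a b => evalb [:: a, b & r] e1 v T1
  end ->
  evalb r (Case (Var x) e0 e1) v T1.+2.
Proof. exact: evalb_Case (evalb_Var _ _). Qed.

Lemma evalb_Call r f args vs v T T1 :
  evalsb r args vs T -> callb f vs v T1 ->
  evalb r (Call f args) v (T + T1).+1.
Proof.
move=> [t H E] [t1 H1 E1]; exists (t + t1).+1; last exact: eval_Call E1.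
by rewrite ltnS leq_add.
Qed.

Lemma evalsb_nil r : evalsb r [::] [::] 0.
Proof. by exists 0 => //; constructor. Qed.

Lemma evalsb_cons r e es v vs T Ts :
  evalb r e v T -> evalsb r es vs Ts -> evalsb r (e :: es) (v :: vs) (T + Ts).
Proof.
move=> [t H E] [t1 H1 E1]; exists (t + t1); last exact: evals_cons.
exact: leq_add.
Qed.

Arguments enc_nat : simpl never.
Arguments enc_list : simpl never.
Arguments enc_elt : simpl never.

Lemma enc_natS n : enc_nat n.+1 = Node Leaf (enc_nat n).
Proof. by []. Qed.

Lemma enc_list_cons (T : Type) (f : T -> data) x s :
  enc_list f (x :: s) = Node (f x) (enc_list f s).
Proof. by []. Qed.

(** [enter] opens the body of the called function and leaves its time bound to be found; [ev] fills
    it in by executing the body, taking inner calls from the context. An inequality between bounds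
    remains. *)
Ltac enter :=
  unfold callb;
  lazymatch goal with |- evalb ?r ?e ?v ?T =>
    let e' := eval hnf in e in change (evalb r e' v T) end;
  eapply evalb_le.

Ltac ev1 :=
  lazymatch goal with
  | |- evalb _ (Case (Var _) _ _) _ _ =>
      eapply evalb_CaseVar; cbn [nth]; rewrite ?enc_natS ?enc_list_cons; simpl
  | |- evalb _ (Case _ _ _) _ _ => eapply evalb_Case
  | |- evalb _ (Var _) _ _ => eapply evalb_Var
  | |- evalb _ ELeaf _ _ => eapply evalb_Leaf
  | |- evalb _ (Let _ _) _ _ => eapply evalb_Let
  | |- evalb _ (Call _ _) _ _ => eapply evalb_Call
  | |- evalb _ _ _ _ => eapply evalb_Node
  | |- evalsb _ [::] _ _ => eapply evalsb_nil
  | |- evalsb _ _ _ _ => eapply evalsb_cons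
  | |- callb _ _ _ _ =>
      cbn [nth]; match goal with H : context [callb] |- _ => eapply H end
  | |- _ => progress (rewrite ?enc_natS; simpl)
  end.
Ltac ev := repeat ev1.

Lemma call_lt a b :
  callb f_lt [:: enc_nat a; enc_nat b] (enc_bool (a < b)) (8 * b + 8).
Proof. by elim: b a => [|b IH] [|a]; enter; ev; lia. Qed.

Lemma call_eq a b :
  callb f_eq [:: enc_nat a; enc_nat b] (enc_bool (a == b)) (8 * a + 8).
Proof. by elim: a b => [|a IH] [|b]; enter; ev; lia. Qed.

Lemma enum_rank_index (T : finType) (x : T) : enum_rank x = index x (enum T) :> nat.
Proof.
by rewrite -{2}(nth_enum_rank x x) index_uniq ?enum_uniq // -cardE.
Qed.

Lemma call_eq_elt (T : finType) (N : nat) (x y : T) :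
  #|T| <= N ->
  callb f_eq [:: enc_elt x; enc_elt y] (enc_bool (x == y)) (8 * N + 8).
Proof.
move=> TN.
have -> : (x == y) = (enum_rank x == enum_rank y :> nat).
  by rewrite -(inj_eq enum_rank_inj).
apply: callb_le (call_eq _ _) _.
by rewrite leq_add2r leq_mul2l ltnW // (leq_trans (ltn_ord _)).
Qed.

Lemma call_nth (T : Type) (f : T -> data) (r : seq T) x0 i :
  i < size r ->
  callb f_nth [:: enc_nat i; enc_list f r] (f (nth x0 r i)) (8 * i + 8).
Proof.
by elim: r i => [//|x r IH] [|i] /= ir; enter; ev => //; lia.
Qed.

Lemma call_nth_elt (T : finType) (N : nat) (f : T -> data) (x : T) :
  #|T| <= N ->
  callb f_nth [:: enc_elt x; enc_list f (enum T)] (f x) (8 * N + 8).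
Proof.
move=> TN.
rewrite -{2}(nth_enum_rank x x); apply: callb_le (call_nth _ _ _) _.
  by rewrite -cardE.
by rewrite leq_add2r leq_mul2l ltnW // (leq_trans (ltn_ord _)).
Qed.

Lemma call_find (T : finType) (N : nat) (x : T) (r : seq T) acc :
  #|T| <= N ->
  callb f_find [:: enc_elt x; enc_list (@enc_elt T) r; enc_nat acc]
    (if x \in r then enc_nat (acc + index x r).+1 else Leaf)
    (size r * (8 * N + 24) + 3).
Proof.
move=> TN.
elim: r acc => [|y r IH] acc; first by enter; ev; lia.
rewrite inE /= (eq_sym y); have := call_eq_elt x y TN.
case: eqP => _ /= E.
  by rewrite addn0 enc_natS; enter; ev; lia.
by rewrite addnS -addSn; have := IH acc.+1 => {}IH; enter; ev; lia.
Qed.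

Lemma call_pad (T : Type) (f : T -> data) (r : seq T) x d :
  callb f_pad [:: enc_list f r; x; d] (iter (size r) (Node x) d)
    (12 * size r + 3).
Proof. by elim: r => [|y r IH]; enter; ev; rewrite /=; lia. Qed.

Lemma iter_Node_nat k j : iter k (Node Leaf) (enc_nat j) = enc_nat (k + j).
Proof. by rewrite /enc_nat iterD. Qed.

Lemma enc_list_nseq (T : Type) (f : T -> data) k x r :
  enc_list f (nseq k x ++ r) = iter k (Node (f x)) (enc_list f r).
Proof. by elim: k => //= k IH; rewrite enc_list_cons IH. Qed.

(** * Costs and correctness of the routines *)

Section Costs.
Variable N : nat.
Definition cost_woman := 8 * N + N * (8 * N + 24) + 80.
Definition cost_level := N * cost_woman + 3.
(** [N.*2.+1] bounds the number [n + q + 1] of levels. *)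
Definition cost_stack := N.*2.+1 * (12 * N + cost_level + 40) + 3.
Definition cost_init := N * (cost_stack + 40) + 3.
Definition max_key := N.*2.+1 * N.
Definition cost_dom := N * (8 * N + 8 * max_key + 80) + 3.
Definition cost_step := N * (cost_dom + 40) + 3.
Definition max_fuel := N * (N.*2.+1 * N).
Definition cost_flat := 20 * N + 12 * max_fuel + 3.
Definition cost_iter := max_fuel * (cost_step + 20) + 3.
Definition cost_prop := N * (8 * N + 60) + 3.
Definition cost_checkm := 40 * N + 8.
Definition cost_checkw := N * (cost_prop + 60) + 8.
Definition cost_out := 40 * N + 3.
Definition cost_main :=
  24 * N + cost_init + cost_flat + cost_iter + cost_checkm + cost_checkw
  + cost_out + 100.
End Costs.

Section Calls.
Variables (I : smc) (N : nat).
Implicit Types (m : men I) (w : women I) (s : state I).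
Local Notation n := #|men I|.
Local Notation q := #|women I|.
Hypothesis menN : n <= N.
Hypothesis womenN : q <= N.
Hypothesis mlistN : forall m, size (mlist m) <= N.

Definition enc_entry (e : women I * nat) : data :=
  Node (enc_elt e.1) (enc_nat e.2).
Definition enc_state s (r : seq (men I)) : data :=
  enc_list (fun m => enc_list enc_entry (s m)) r.

Lemma enc_state_cons s m r :
  enc_state s (m :: r) = Node (enc_list enc_entry (s m)) (enc_state s r).
Proof. by []. Qed.

Lemma call_allow mode m w :
  callb f_allow
    [:: enc_nat mode; enc_bool (m \in mstar I); enc_bool (w \in wstar I)]
    (enc_bool (allow mode m w)) 8.
Proof. by case: mode => [|[|mode]]; enter; ev. Qed.

Lemma call_level m off mode rest :
  callb f_level
    [:: enc_elt m; enc_bool (m \in mstar I); enc_list (@enc_elt _) (mlist m);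
        enc_list (@enc_woman I) (enum (women I)); enc_nat off; enc_nat mode;
        enc_list enc_entry rest]
    (enc_list enc_entry (level m off mode ++ rest)) (cost_level N).
Proof.
suff H (r : seq (women I)) :
    callb f_level
      [:: enc_elt m; enc_bool (m \in mstar I); enc_list (@enc_elt _) r;
          enc_list (@enc_woman I) (enum (women I)); enc_nat off; enc_nat mode;
          enc_list enc_entry rest]
      (enc_list enc_entry ([seq (w, off + index m (wlist w)) |
         w <- [seq w <- r | allow mode m w && (m \in wlist w)]] ++ rest))
      (size r * cost_woman N + 3).
  by apply: callb_le (H _) _; rewrite leq_add2r leq_mul2r mlistN orbT.
elim: r => [|w r IH]; first by enter; ev.
have Hn := call_nth_elt (@enc_woman I) w womenN.
have Ha := call_allow mode m w.
have Hf := call_find m (wlist w) off menN.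
have wN : 8 * N + size (wlist w) * (8 * N + 24) + 80 <= cost_woman N.
  rewrite leq_add2r leq_add2l leq_mul2r -(card_uniqP (wlist_uniq w)).
  by rewrite (leq_trans (max_card _)) ?orbT.
(* The product is made atomic, so that the remaining inequalities are linear. *)
move: (size (wlist w) * (8 * N + 24)) Hf wN => c Hf wN.
rewrite /=; case: (allow mode m w) Ha => /= Ha; last by enter; ev; lia.
by case: (m \in wlist w) Hf => /= Hf; enter; ev; lia.
Qed.

Lemma call_stack m sched off rest :
  callb f_stack
    [:: enc_list enc_nat sched; enc_elt m; enc_bool (m \in mstar I);
        enc_list (@enc_elt _) (mlist m);
        enc_list (@enc_man I) (enum (men I));
        enc_list (@enc_woman I) (enum (women I)); enc_nat off;
        enc_list enc_entry rest]
    (enc_list enc_entry (stack_levels m sched off rest))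
    (size sched * (12 * N + cost_level N + 40) + 3).
Proof.
elim: sched off rest => [|mode sched IH] off rest; first by enter; ev.
have Hl := call_level m off mode rest.
have Hp := call_pad (@enc_man I) (enum (men I)) Leaf (enc_nat off).
rewrite iter_Node_nat -cardE in Hp.
have {}Hp := callb_le Hp (leq_add (leq_mul (leqnn 12) menN) (leqnn 3)).
have {}IH := IH (n + off) (level m off mode ++ rest).
by enter; ev; rewrite /=; lia.
Qed.

(** Persons are numbered in unary along the enumeration, so a counter carried through the traversal
    is the code of the current person. *)
Lemma enum_rank_cat (T : finType) (pre : seq T) x r :
  enum T = pre ++ x :: r -> enc_elt x = enc_nat (size pre).
Proof.
move=> E; rewrite /enc_elt enum_rank_index E index_cat /= eqxx addn0.
by have := enum_uniq T; rewrite E cat_uniq /= negb_or; case/and3P => _ /andP[/negPf-> _] _.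
Qed.

Lemma call_init :
  callb f_init
    [:: enc_list (@enc_man I) (enum (men I)); Leaf;
        enc_list (@enc_man I) (enum (men I));
        enc_list (@enc_woman I) (enum (women I));
        enc_list enc_nat (schedule I)]
    (enc_state (init_state I) (enum (men I))) (cost_init N).
Proof.
suff H (r pre : seq (men I)) : enum (men I) = pre ++ r ->
    callb f_init
      [:: enc_list (@enc_man I) r; enc_nat (size pre);
          enc_list (@enc_man I) (enum (men I));
          enc_list (@enc_woman I) (enum (women I));
          enc_list enc_nat (schedule I)]
      (enc_state (init_state I) r) (size r * (cost_stack N + 40) + 3).
  apply: callb_le (H _ [::] erefl) _.
  by rewrite /cost_init leq_add2r leq_mul2r -cardE menN orbT.
elim: r pre => [|m r IH] pre E; first by enter; ev.
have {}IH : callb f_init _ _ _ := IH (rcons pre m) _.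
have := IH; rewrite cat_rcons size_rcons enc_natS => /(_ E) {}IH.
have Hs := call_stack m (schedule I) 0 [::].
have Lb : size (schedule I) * (12 * N + cost_level N + 40) + 3 <= cost_stack N.
  rewrite /cost_stack leq_add2r leq_mul2r size_schedule -addnn ltnS.
  by rewrite leq_add ?orbT.
rewrite (enum_rank_cat E) in Hs.
by rewrite enc_state_cons ffunE; enter; ev; rewrite /=; lia.
Qed.

(** The key is bounded because comparing keys takes time linear in [k]. *)
Lemma call_dom s w k :
  k <= max_key N ->
  callb f_dom [:: enc_elt w; enc_nat k; enc_state s (enum (men I))]
    (enc_bool (dominated s (w, k))) (cost_dom N).
Proof.
move=> kN; rewrite /dominated.
suff H (r : seq (men I)) :
    callb f_dom [:: enc_elt w; enc_nat k; enc_state s r]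
      (enc_bool (has (fun m => beats (s m) (w, k)) r))
      (size r * (8 * N + 8 * max_key N + 80) + 3).
  apply: callb_le (H _) _.
  by rewrite /cost_dom leq_add2r leq_mul2r -cardE menN orbT.
elim: r => [|m r IH]; first by enter; ev.
rewrite enc_state_cons /= /beats.
case: (s m) => [|[w' k'] l] /=; first by enter; ev; lia.
rewrite enc_list_cons.
have := call_eq_elt w' w womenN; have := call_lt k' k.
by case: (w' == w) => /=; case: (k' < k) => /= H1 H2; enter; ev; lia.
Qed.

Lemma call_step s :
  (forall m, {in s m, forall e, e.2 <= max_key N}) ->
  callb f_step [:: enc_state s (enum (men I)); enc_state s (enum (men I))]
    (enc_state (step s) (enum (men I))) (cost_step N).
Proof.
move=> sN.
suff H (r : seq (men I)) :
    callb f_step [:: enc_state s r; enc_state s (enum (men I))]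
      (enc_state (step s) r) (size r * (cost_dom N + 40) + 3).
  apply: callb_le (H _) _.
  by rewrite /cost_step leq_add2r leq_mul2r -cardE menN orbT.
elim: r => [|m r IH]; first by enter; ev.
rewrite !enc_state_cons ffunE.
case E: (s m) => [|[w k] l] /=; first by enter; ev; lia.
have := @call_dom s w k; rewrite (sN m (w, k)) ?E ?mem_head // => /(_ isT).
rewrite /reject; case: (dominated s (w, k)) => /= Hd.
  by rewrite enc_list_cons; enter; ev; lia.
by rewrite [in enc_list _ ((w,k) :: l)]enc_list_cons; enter; ev; lia.
Qed.

Lemma call_flat s (r : seq (men I)) :
  callb f_flat [:: enc_state s r] (enc_nat (\sum_(m <- r) size (s m)))
    (20 * size r + 12 * \sum_(m <- r) size (s m) + 3).
Proof.
elim: r => [|m r IH]; first by rewrite big_nil; enter; ev.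
have Hp := call_pad enc_entry (s m) Leaf (enc_nat (\sum_(m <- r) size (s m))).
rewrite iter_Node_nat in Hp; rewrite big_cons enc_state_cons.
move: (\sum_(m <- r) size (s m)) IH Hp => k IH Hp.
by enter; ev; rewrite /=; lia.
Qed.

(** Stated for iterates of the initial state, whose entries are genuine proposals and hence have
    keys below [max_key N]. *)
Lemma call_iter k j :
  callb f_iter
    [:: enc_nat k; enc_state (iter j (@step I) (init_state I)) (enum (men I))]
    (enc_state (iter (k + j) (@step I) (init_state I)) (enum (men I)))
    (k * (cost_step N + 20) + 3).
Proof.
elim: k j => [|k IH] j; first by enter; ev.
have {}IH := IH j.+1; rewrite -addSnnS in IH.
have kN m : {in iter j (@step I) (init_state I) m, forall e, e.2 <= max_key N}.
  move=> e /iter_step_subset /key_proposals /ltnW /leq_trans; apply.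
  by rewrite leq_mul // ltnS -addnn leq_add.
have Hs := call_step kN; rewrite -iterS in Hs.
by enter; ev; lia.
Qed.

Lemma call_prop s w :
  callb f_prop [:: enc_elt w; enc_state s (enum (men I))]
    (enc_bool (proposed_to s w)) (cost_prop N).
Proof.
rewrite /proposed_to.
suff H (r : seq (men I)) :
    callb f_prop [:: enc_elt w; enc_state s r]
      (enc_bool (has (fun m => if s m is h :: _ then h.1 == w else false) r))
      (size r * (8 * N + 60) + 3).
  apply: callb_le (H _) _.
  by rewrite /cost_prop leq_add2r leq_mul2r -cardE menN orbT.
elim: r => [|m r IH]; first by enter; ev.
rewrite enc_state_cons /=.
case: (s m) => [|[w' k'] l] /=; first by enter; ev; lia.
rewrite enc_list_cons; have := call_eq_elt w' w womenN.
by case: (w' == w) => /= H; enter; ev; lia.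
Qed.

Lemma call_checkm s :
  callb f_checkm
    [:: enc_list (@enc_man I) (enum (men I)); enc_state s (enum (men I))]
    (enc_bool (covers_men s)) (cost_checkm N).
Proof.
rewrite /covers_men.
suff H (r : seq (men I)) :
    callb f_checkm [:: enc_list (@enc_man I) r; enc_state s r]
      (enc_bool (all (fun m => (m \in mstar I) ==> (s m != [::])) r))
      (40 * size r + 8).
  apply: callb_le (H _) _.
  by rewrite /cost_checkm leq_add2r leq_mul2l -cardE menN.
elim: r => [|m r IH]; first by enter; ev.
rewrite enc_state_cons enc_list_cons /enc_man /=.
by case: (m \in mstar I); case: (s m) => [|e l] /=;
  rewrite ?enc_list_cons; enter; ev; lia.
Qed.

Lemma call_checkw s :
  callb f_checkw
    [:: enc_list (@enc_woman I) (enum (women I)); Leaf;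
        enc_state s (enum (men I))]
    (enc_bool (covers_women s)) (cost_checkw N).
Proof.
rewrite /covers_women.
suff H (r pre : seq (women I)) : enum (women I) = pre ++ r ->
    callb f_checkw
      [:: enc_list (@enc_woman I) r; enc_nat (size pre);
          enc_state s (enum (men I))]
      (enc_bool (all (fun w => (w \in wstar I) ==> proposed_to s w) r))
      (size r * (cost_prop N + 60) + 8).
  apply: callb_le (H _ [::] erefl) _.
  by rewrite /cost_checkw leq_add2r leq_mul2r -cardE womenN orbT.
elim: r pre => [|w r IH] pre E; first by enter; ev.
have := IH (rcons pre w); rewrite cat_rcons size_rcons enc_natS => /(_ E) {}IH.
have := call_prop s w; rewrite (enum_rank_cat E) enc_list_cons /enc_woman /=.
by case: (w \in wstar I); case: (proposed_to s w) => /= H; enter; ev; lia.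
Qed.

Lemma call_out s :
  callb f_out [:: enc_state s (enum (men I)); Leaf]
    (enc_list (fun e => Node (enc_elt e.1) (enc_elt e.2))
       (marriages s (enum (men I)))) (cost_out N).
Proof.
suff H (r pre : seq (men I)) : enum (men I) = pre ++ r ->
    callb f_out [:: enc_state s r; enc_nat (size pre)]
      (enc_list (fun e => Node (enc_elt e.1) (enc_elt e.2)) (marriages s r))
      (40 * size r + 3).
  apply: callb_le (H _ [::] erefl) _.
  by rewrite /cost_out leq_add2r leq_mul2l -cardE menN.
elim: r pre => [|m r IH] pre E; first by enter; ev.
have := IH (rcons pre m); rewrite cat_rcons size_rcons enc_natS => /(_ E) {}IH.
rewrite enc_state_cons /marriages /=.
case: (s m) => [|[w k] l] /=; first by enter; ev; lia.
by rewrite !enc_list_cons (enum_rank_cat E); enter; ev; lia.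
Qed.

Lemma fuel_le : fuel I <= max_fuel N.
Proof.
apply: (@leq_trans (\sum_(m : men I) N.*2.+1 * N)); last first.
  by rewrite sum_nat_const leq_mul2r menN orbT.
apply: leq_sum => m _; apply: leq_trans (size_proposals m) _.
by rewrite leq_mul // ltnS -addnn leq_add.
Qed.

Lemma call_main :
  callb 0 [:: enc_smc I] (enc_output (solution I)) (cost_main N).
Proof.
have Hw := call_pad (@enc_woman I) (enum (women I)) (enc_nat 2) Leaf.
have Hm := call_pad (@enc_man I) (enum (men I)) Leaf
  (Node (enc_nat 1) (iter (size (enum (women I))) (Node (enc_nat 2)) Leaf)).
(* The lists of persons serve as unary counters: one padding per sex builds the schedule around its
   middle entry [1]. *)
have schedE : iter (size (enum (men I))) (Node Leaf)
    (Node (enc_nat 1) (iter (size (enum (women I))) (Node (enc_nat 2)) Leaf))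
  = enc_list enc_nat (schedule I).
  rewrite /schedule enc_list_nseq enc_list_cons -[nseq q 2]cats0 enc_list_nseq.
  by rewrite -!cardE.
rewrite schedE in Hm.
have mN : 12 * size (enum (men I)) + 3 <= 12 * N + 3.
  by rewrite leq_add2r leq_mul2l -cardE menN.
have wN : 12 * size (enum (women I)) + 3 <= 12 * N + 3.
  by rewrite leq_add2r leq_mul2l -cardE womenN.
have {}Hm := callb_le Hm mN; have {}Hw := callb_le Hw wN.
have Hi := call_init.
have fE : \sum_(m <- enum (men I)) size (init_state I m) = fuel I.
  by rewrite big_enum; apply: eq_bigr => m _; rewrite ffunE.
have Hf := call_flat (init_state I) (enum (men I)).
rewrite fE in Hf.
have fN : 20 * size (enum (men I)) + 12 * fuel I + 3 <= cost_flat N.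
  by rewrite leq_add2r leq_add // leq_mul2l ?fuel_le // -cardE menN.
have {}Hf := callb_le Hf fN.
have Ht := call_iter (fuel I) 0; rewrite addn0 -/(final_state I) in Ht.
have tN : fuel I * (cost_step N + 20) + 3 <= cost_iter N.
  by rewrite leq_add2r leq_mul2r fuel_le orbT.
have {}Ht := callb_le Ht tN.
have Hcm := call_checkm (final_state I); have Hcw := call_checkw (final_state I).
have Ho := call_out (final_state I).
rewrite /solution /cost_main.
by case: (covers_men _) Hcm => Hcm; case: (covers_women _) Hcw => Hcw /=;
  enter; ev; lia.
Qed.
End Calls.

(** * Polynomial bounds *)

Definition poly (f : nat -> nat) : Prop :=
  exists c k, forall x, f x <= c * x.+1 ^ k.

Lemma poly_id : poly id.
Proof. by exists 1, 1 => x; rewrite mul1n expn1. Qed.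

Lemma poly_const c : poly (fun _ => c).
Proof. by exists c, 0 => x; rewrite expn0 muln1. Qed.

(** The base [x.+1] is positive, so both exponents can be raised to [k + l], even at [x = 0]. *)
Lemma poly_add f g : poly f -> poly g -> poly (fun x => f x + g x).
Proof.
move=> [c [k H]] [d [l K]]; exists (c + d), (k + l) => x; rewrite mulnDl.
apply: leq_add; [apply: leq_trans (H x) _|apply: leq_trans (K x) _];
  by rewrite leq_mul2l leq_pexp2l ?leq_addr ?leq_addl ?orbT.
Qed.

Lemma poly_mul f g : poly f -> poly g -> poly (fun x => f x * g x).
Proof.
move=> [c [k H]] [d [l K]]; exists (c * d), (k + l) => x.
by rewrite expnD mulnACA leq_mul.
Qed.

Lemma poly_cost_main : poly cost_main.
Proof.
have poly_double : poly double.
  by have [c [k H]] := poly_add poly_id poly_id; exists c, k => x; rewrite -addnn.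
have poly_odd : poly (fun x => x.*2.+1).
  have [c [k H]] := poly_add poly_double (poly_const 1).
  by exists c, k => x; rewrite -addn1.
rewrite /cost_main /cost_init /cost_stack /cost_level /cost_woman /cost_flat
  /cost_iter /cost_step /cost_dom /max_key /max_fuel /cost_checkm /cost_checkw
  /cost_prop /cost_out.
by repeat first [ exact: poly_odd | exact: poly_id | exact: poly_const
                | apply: poly_add | apply: poly_mul ].
Qed.

(** For positive arguments [x.+2 <= 2 * x.+1] costs the factor [2 ^ k]; the additive constant
    handles [0]. *)
Lemma poly_bound f :
  poly f -> exists c k, forall x, f x <= c * x ^ k + c.
Proof.
move=> [c [k H]]; exists (c * 2 ^ k), k => -[|x]; apply: leq_trans (H _) _.
  by rewrite exp1n muln1 (leq_trans _ (leq_addl _ _)) // leq_pmulr // expn_gt0.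
rewrite -mulnA -expnMn (leq_trans _ (leq_addr _ _)) // leq_mul2l.
by case: k {H} => [|k]; rewrite ?orbT // leq_exp2r ?orbT //; apply/orP; right; lia.
Qed.

Theorem theorem4 :
  exists (p : program) (c k : nat),
  forall I : smc,
  exists (o : option (seq (men I * women I))) (t : nat),
    [/\ run p (enc_smc I) (enc_output o) t,
        t <= c * smc_size I ^ k + c
      & match o with
        | Some s =>
            let M := [set e in s] in
            [/\ is_matching M,
                feasible M
              & (#|blocking_pairs M|%:Z <=
                   ((Delta_women I)%:Z - 1) * #|mstar I|%:Z
                   + ((Delta_men I)%:Z - 1) * #|wstar I|%:Z)%R]
        | None =>
            ~ exists M : {set men I * women I}, is_matching M /\ feasible M
        end].
Proof.
have [c [k cN]] := poly_bound poly_cost_main.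
exists prog, c, k => I; exists (solution I).
(* The size of the instance serves as [N]: it bounds both numbers of persons and the length of every
   list of a man. *)
have [|||t tN Ht] := @call_main I (smc_size I).
- by rewrite /smc_size -!addnA leq_addr.
- by rewrite /smc_size -!addnA (leq_trans _ (leq_addl _ _)) // leq_addr.
- move=> m; rewrite /smc_size (leq_trans _ (leq_addr _ _)) //.
  by rewrite (leq_trans _ (leq_addl _ _)) // (bigD1 m) //= leq_addr.
exists t; split; [exact: Ht|exact: leq_trans (cN _)|exact: solution_correct].
Qed.
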